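(* Let $p\ge 1$ and let $F=f+\psi$ be as in the context, with $p$th derivative of $f$ Lipschitz continuous with constant $L_p$. Let the inner accuracies be chosen according to the rule $$\delta_k := \frac{c}{k^{p+1}},\qquad k\ge1,$$ for some $c\ge0$. Then for the sequence $\{x_k\}_{k\ge1}$ produced by the Inexact Tensor Method with Averaging (described in the context) we have, for all $k\ge1$, $$F(x_k)-F^*\;\le\;\frac{(p+1)^{p+1}L_p\|x_0-x^*\|^{p+1}}{p!\,k^p}+\frac{c}{k^p}.$$
   Context: Setting. $\mathbb{E}$ is a finite-dimensional real vector space with dual $\mathbb{E}^*$, and $\langle s,x\rangle$ is the value of $s\in\mathbb{E}^*$ at $x\in\mathbb{E}$. $B:\mathbb{E}\to\mathbb{E}^*$ is a fixed symmetric positive definite linear operator and $\|x\|=\langle Bx,x\rangle^{1/2}$. For a $p$-linear symmetric form, $\|D^pf(x)\|=\max_{\|h_i\|\le 1}D^pf(x)[h_1,\dots,h_p]$; $D^kf(x)[h]^k$ denotes the $k$th directional derivative along $h$ taken $k$ times. Problem: minimize $F(x)=f(x)+\psi(x)$ over $x\in\mathbb{E}$, where $\psi:\mathbb{E}\to\mathbb{R}\cup\{+\infty\}$ is proper closed convex and $f:\operatorname{dom}\psi\to\mathbb{R}$ is convex and (sufficiently many times, at least $p$ times) differentiable. A solution $x^*\in\operatorname{dom}\psi$ is assumed to exist and is fixed; $F^*=F(x^* )$. Lipschitz assumption: $\|D^pf(x)-D^pf(y)\|\le L_p\|x-y\|$ for all $x,y\in\operatorname{dom}\psi$. Model: for $H\ge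 0$, $$\Omega_H(x;y)=f(x)+\sum_{k=1}^p\frac1{k!}D^kf(x)[y-x]^k+\frac{H\|y-x\|^{p+1}}{(p+1)!}+\psi(y).$$ Inexact $\delta$-step: $T_{H,\delta}(x)$ denotes any point $T\in\operatorname{dom}\psi$ with $\Omega_H(x;T)-\min_y\Omega_H(x;y)\le\delta$. Inexact Tensor Method with Averaging: choose $x_0\in\operatorname{dom}\psi$, fix $H:=pL_p$. For $k=0,1,2,\dots$: set $\lambda_k:=\bigl(\frac{k}{k+1}\bigr)^{p+1}$ and $y_k:=\lambda_kx_k+(1-\lambda_k)x_0$; given $\delta_{k+1}\ge0$, compute $x_{k+1}:=T_{H,\delta_{k+1}}(y_k)$. *)

(* Defs.v *)
From HB Require Import structures.
From mathcomp Require Import all_boot all_order all_algebra all_fingroup.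
From mathcomp Require Import all_classical all_reals all_analysis.
From mathcomp Require Import ring lra.
Set Implicit Arguments.
Unset Strict Implicit.
Unset Printing Implicit Defensive.
Import Order.TTheory GRing.Theory Num.Theory.
Import numFieldNormedType.Exports.
Local Open Scope classical_set_scope.
Local Open Scope ring_scope.

(* The dual space E^* is 'Hom(E, R^o), so that <B x, y> is B x y. *)
Record spd_op (R : realType) (E : vectType R) := SpdOp {
  spd_fun :> 'Hom(E, 'Hom(E, R^o));
  spd_sym : forall x y, spd_fun x y = spd_fun y x;
  spd_gt0 : forall x, x != 0 -> 0 < spd_fun x x }.

(* The space E carrying the norm <B x, x>^(1/2). *)
Definition euclidean (R : realType) (E : vectType R) (B : spd_op E) : Type := E.

Section euclidean_norm.
Context (R : realType) (E : vectType R) (B : spd_op E).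

HB.instance Definition _ := Vector.on (euclidean B).

Definition spd_norm (x : euclidean B) : R := Num.sqrt (B x x).

Let BDl (x y z : E) : B (x + y) z = B x z + B y z.
Proof. by rewrite linearD/= add_lfunE. Qed.

Let BDr (x y z : E) : B z (x + y) = B z x + B z y.
Proof. by rewrite linearD. Qed.

Let BZl a (x y : E) : B (a *: x) y = a * B x y.
Proof. by rewrite linearZ/= scale_lfunE. Qed.

Let BZr a (x y : E) : B x (a *: y) = a * B x y.
Proof. by rewrite linearZ. Qed.

Let B_ge0 (x : E) : 0 <= B x x.
Proof.
have [->|x0] := eqVneq x 0; first by rewrite linear0.
exact/ltW/spd_gt0.
Qed.

Let cauchy_schwarz (x y : E) : B x y ^+ 2 <= B x x * B y y.
Proof.
have [->|y0] := eqVneq y 0; first by rewrite !linear0 expr0n mulr0.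
have yy := spd_gt0 B y0.
have := B_ge0 (B y y *: x - B x y *: y).
rewrite -!scaleNr BDl !BDr !BZl !BZr (spd_sym B y x) => h.
rewrite -subr_ge0 -(pmulr_rge0 _ yy).
by apply: le_trans h _; rewrite le_eqVlt; apply/orP; left; apply/eqP; ring.
Qed.

Let spd_normD x y : spd_norm (x + y) <= spd_norm x + spd_norm y.
Proof.
rewrite -(@ler_pXn2r _ 2)// ?nnegrE ?addr_ge0 ?sqrtr_ge0//.
rewrite sqrrD !sqr_sqrtr ?B_ge0// BDl !BDr (spd_sym B y x).
rewrite [leRHS]addrAC -addrA [leRHS]addrC.
suff : B x y <= spd_norm x * spd_norm y by lra.
rewrite (le_trans (ler_norm _))// -sqrtrM ?B_ge0// -sqrtr_sqr.
by rewrite ler_wsqrtr// cauchy_schwarz.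
Qed.

Let spd_normZ (l : R) x : spd_norm (l *: x) = `|l| * spd_norm x.
Proof.
by rewrite /spd_norm BZl BZr mulrA -expr2 sqrtrM ?sqr_ge0// sqrtr_sqr.
Qed.

Let spd_norm_eq0 x : spd_norm x = 0 -> x = 0.
Proof.
move=> /eqP; rewrite sqrtr_eq0 => Bx; apply/eqP/negPn/negP => /(spd_gt0 B).
by rewrite ltNge Bx.
Qed.

HB.instance Definition _ := Lmodule_isNormed.Build R (euclidean B)
  spd_normD spd_normZ spd_norm_eq0.

Lemma euclidean_normE (x : euclidean B) : `|x| = Num.sqrt (B x x).
Proof. by []. Qed.

End euclidean_norm.

Section forms.
Context (R : realType) (V : normedModType R).

Definition form_on k := ('I_k -> V) -> R.

Definition multilinear k (M : form_on k) :=
  forall (h : 'I_k -> V) (i : 'I_k), linear (fun u : V => M (dfwith h i u) : R^o).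

Definition form_symmetric k (M : form_on k) :=
  forall (s : 'S_k) (h : 'I_k -> V), M (h \o s) = M h.

(* As an extended real, so that no boundedness is presupposed; multilinearity
   makes it finite, the supremum being attained, when V has finite dimension. *)
Definition form_norm k (M : form_on k) : \bar R :=
  ereal_sup [set (M h)%:E | h in [set h : 'I_k -> V | forall i, `|h i| <= 1]].

Definition ocons k (v : V) (h : 'I_k -> V) : 'I_k.+1 -> V :=
  fun i => oapp h v (unlift ord0 i).

(* D k x stands for D^k f(x), k <= p. As A (the domain of f) need not be open,
   the derivatives are taken relative to A; they are a datum because they are
   not unique when A has empty interior. Fréchet differentiability of the map
   D k into the finite dimensional space of k-forms is stated evaluation by
   evaluation. *)
Record derivatives_on (A : set V) (f : V -> R) (p : nat)
    (D : forall k, V -> form_on k) : Prop := DerivativesOn {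
  derivatives_on0 : forall x h, A x -> D 0%N x h = f x;
  derivatives_on_multilinear : forall k x, (k <= p)%N -> A x ->
    multilinear (D k x);
  derivatives_on_symmetric : forall k x, (k <= p)%N -> A x ->
    form_symmetric (D k x);
  derivatives_onS : forall k x h, (k < p)%N -> A x ->
    (fun y => D k y h - D k x h - D k.+1 x (ocons (y - x) h))
      =o_ (within A (nbhs x)) (fun y => y - x) }.

Definition lipschitz_form (A : set V) k (M : V -> form_on k) (L : R) :=
  forall x y, A x -> A y ->
    (form_norm (fun h => M x h - M y h)%R <= (L * `|x - y|)%:E)%E.

End forms.

Section composite.
Context (R : realType) (V : normedModType R).
Local Open Scope ereal_scope.

Definition effdom (psi : V -> \bar R) : set V := [set x | psi x < +oo].

Definition proper_fun (psi : V -> \bar R) :=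
  (forall x, psi x != -oo) /\ effdom psi !=set0.

Definition closed_fun (psi : V -> \bar R) :=
  closed [set z : V * R | psi z.1 <= z.2%:E].

(* With values in R U {+oo} and the convention 0 * +oo = 0. *)
Definition convex_fun (psi : V -> \bar R) :=
  forall x y (t : R), (0 <= t <= 1)%R ->
    psi (t *: x + (1 - t) *: y)%R <= t%:E * psi x + (1 - t)%:E * psi y.

(* f is only meaningful on effdom psi; outside of it the objective is +oo. *)
Definition objective (f : V -> R) (psi : V -> \bar R) (x : V) : \bar R :=
  (f x)%:E + psi x.

Definition solution (f : V -> R) (psi : V -> \bar R) (xs : V) :=
  effdom psi xs /\ forall y, objective f psi xs <= objective f psi y.

Definition model (p : nat) (f : V -> R) (D : forall k, V -> form_on V k)
    (psi : V -> \bar R) (H : R) (x y : V) : \bar R :=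
  (f x + \sum_(1 <= k < p.+1) (k`!%:R)^-1 * D k x (fun=> y - x)
   + H * `|y - x| ^+ p.+1 / (p.+1)`!%:R)%:E + psi y.

(* The infimum over y is in fact a minimum under the standing assumptions with
   H = p L; if it were -oo, no T would qualify. *)
Definition inexact_step (p : nat) (f : V -> R) (D : forall k, V -> form_on V k)
    (psi : V -> \bar R) (H delta : R) (x T : V) :=
  effdom psi T /\
  model p f D psi H x T - ereal_inf (range (model p f D psi H x)) <= delta%:E.

Local Open Scope ring_scope.

Definition avg_weight (p k : nat) : R := (k%:R / k.+1%:R) ^+ p.+1.

Definition averaging_point (p : nat) (x : nat -> V) (k : nat) : V :=
  avg_weight p k *: x k + (1 - avg_weight p k) *: x 0%N.

Definition inexact_tensor_averaging (p : nat) (f : V -> R)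
    (D : forall k, V -> form_on V k) (psi : V -> \bar R) (L : R)
    (delta : nat -> R) (x : nat -> V) :=
  effdom psi (x 0%N) /\
  forall k, inexact_step p f D psi (p%:R * L) (delta k.+1)
              (averaging_point p x k) (x k.+1).

End composite.

(* Main.v *)
(* Taylor's formula along a segment gives |F - (f's Taylor model + psi)| <=
   L |y - x|^(p+1) / (p+1)!, so that a delta-step T from x with H = pL satisfies
   F(T) <= F(y) + L |y - x|^(p+1) / p! + delta for every y in dom psi.
   Take x = y_k, y = lambda_k x_k + (1 - lambda_k) x*; then
   y - y_k = (1 - lambda_k)(x* - x_0), and convexity of F yields, after
   multiplication by (k+1)^(p+1),
     (k+1)^(p+1) (F(x_(k+1)) - F* ) <= k^(p+1) (F(x_k) - F* )
       + L ((k+1)(1 - lambda_k) |x_0 - x^*|)^(p+1) / p! + c,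
   where (k+1)(1 - lambda_k) <= p + 1. Summing, the right-hand side grows
   linearly in k; divide by k^(p+1). *)
Require Import Defs.
From mathcomp Require Import all_boot all_order all_algebra all_fingroup.
From mathcomp Require Import all_classical all_reals all_analysis.
From mathcomp Require Import ring lra.
Set Implicit Arguments.
Unset Strict Implicit.
Unset Printing Implicit Defensive.
Import Order.TTheory GRing.Theory Num.Theory.
Import numFieldNormedType.Exports.
Local Open Scope classical_set_scope.
Local Open Scope ring_scope.

(** * Taylor's formula in one variable with a Lipschitz-type remainder *)

Section taylor_one_variable.
Context (R : realType).
Implicit Types (h dh : R -> R) (g : nat -> R -> R) (M t : R).

(** Cauchy's mean value theorem compares [h] with s^(m+1)/(m+1)!, whose derivative s^m/m! is
    positive on the open interval; this replaces integrating the bound on [dh]. *)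
Lemma le_power_of_derive_le h dh m M t : 0 < t ->
  {within `[0, t], continuous h} ->
  (forall s : R, s \in `]0, t[ -> is_derive s 1 h (dh s)) ->
  (forall s : R, s \in `]0, t[ -> `|dh s| <= M * s ^+ m / m`!%:R) ->
  `|h t - h 0| <= M * t ^+ m.+1 / m.+1`!%:R.
Proof.
move=> t0 hc hd dhM.
pose q : {poly R} := (m.+1`!%:R)^-1 *: 'X^(m.+1).
have qE s : q.[s] = s ^+ m.+1 / m.+1`!%:R.
  by rewrite /q hornerZ hornerXn mulrC.
have dqE s : q^`().[s] = s ^+ m / m`!%:R.
  rewrite /q derivZ derivXn hornerZ hornerMn hornerXn /= factS natrM.
  rewrite -mulr_natl invfM.
  have : (m.+1%:R : R) != 0 by [].
  have : (m`!%:R : R) != 0 by rewrite pnatr_eq0 -lt0n fact_gt0.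
  by move=> ? ?; field; rewrite nat1r; apply/andP.
have dq_gt0 s : s \in `]0, t[ -> 0 < q^`().[s].
  rewrite in_itv/= => /andP[s0 _].
  by rewrite dqE divr_gt0 ?exprn_gt0// ltr0n fact_gt0.
have [||s st] := @cauchy_MVT _ h dh (horner q) (horner q^`()) _ _ t0 hc.
- apply: derivable_within_continuous => s _.
  by have [] := is_derive_poly q s.
- by move=> s st; rewrite gt_eqF// dq_gt0.
rewrite qE [q.[0]]qE expr0n mul0r subr0 => hE.
have q_gt0 : 0 < t ^+ m.+1 / m.+1`!%:R.
  by rewrite divr_gt0 ?exprn_gt0// ltr0n fact_gt0.
have -> : h t - h 0 = dh s / q^`().[s] * (t ^+ m.+1 / m.+1`!%:R).
  by rewrite hE mulfVK ?gt_eqF.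
rewrite normrM normf_div (gtr0_norm q_gt0) (gtr0_norm (dq_gt0 _ st)) -mulrA.
by rewrite ler_wpM2r ?(ltW q_gt0)// ler_pdivrMr ?dq_gt0// dqE mulrA dhM.
Qed.

(** Induction on [m]: the derivative of the Taylor remainder is the remainder of the shifted family
    [g k.+1]. The induction hypothesis bounds it, and the preceding lemma integrates that bound. *)
Lemma taylor_le m g M :
  (forall k, (k < m)%N -> {within `[0, 1], continuous g k}) ->
  (forall k t, (k < m)%N -> t \in `]0, 1[ -> is_derive t 1 (g k) (g k.+1 t)) ->
  (forall t : R, t \in `[0, 1] -> `|g m t - g m 0| <= M * t) ->
  forall t : R, t \in `[0, 1] ->
    `|g 0%N t - \sum_(j < m.+1) g j 0 / j`!%:R * t ^+ j|
      <= M * t ^+ m.+1 / m.+1`!%:R.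
Proof.
elim: m g => [|m IH] g gc gd gM t t01.
  by rewrite big_ord1 fact0 divr1 expr0 mulr1 expr1 divr1 gM.
(* The mean value argument needs a nondegenerate interval, so t = 0 is treated apart. *)
have [->|t_neq0] := eqVneq t 0.
  rewrite big_ord_recl fact0 divr1 expr0 mulr1 expr0n mulr0 mul0r.
  rewrite big1 ?addr0 ?subrr ?normr0// => j _.
  by rewrite expr0n mulr0.
have t_gt0 : 0 < t.
  by move: t01; rewrite in_itv/= lt0r t_neq0 => /andP[].
have t_le1 : t <= 1 by move: t01; rewrite in_itv/= => /andP[].
have sub_oo s : s \in `]0, t[ -> s \in `]0, 1[.
  by rewrite !in_itv/= => /andP[-> /lt_le_trans->].
pose P : {poly R} := \poly_(j < m.+2) (g j 0 / j`!%:R).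
have PE s : P.[s] = \sum_(j < m.+2) g j 0 / j`!%:R * s ^+ j.
  by rewrite horner_poly.
have dPE s : P^`().[s] = \sum_(j < m.+1) g j.+1 0 / j`!%:R * s ^+ j.
  have -> : P^`() = \poly_(j < m.+1) (g j.+1 0 / j`!%:R).
    apply/polyP => j; rewrite coef_deriv !coef_poly ltnS; case: ifP => _.
      rewrite factS natrM invfM -mulr_natl.
      have : (j.+1%:R : R) != 0 by [].
      have : (j`!%:R : R) != 0 by rewrite pnatr_eq0 -lt0n fact_gt0.
      by move=> ? ?; field; rewrite nat1r; apply/andP.
    by rewrite mul0rn.
  by rewrite horner_poly.
pose h s := g 0%N s - P.[s].
have hc : {within `[0, t], continuous h}.
  have h01 : {within `[0, 1], continuous h}.
    move=> s; apply: continuousB; first exact: gc.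
    have dP : {in `[0, 1], forall u, derivable (horner P) u 1}.
      by move=> u _; have [] := is_derive_poly P u.
    exact: (derivable_within_continuous dP).
  by apply: continuous_subspaceW h01; apply: subset_itvl; rewrite bnd_simp.
have hd s : s \in `]0, t[ -> is_derive s 1 h (g 1%N s - P^`().[s]).
  by move=> st; apply: is_deriveB; exact/gd/sub_oo.
have h'M s : s \in `]0, t[ ->
    `|g 1%N s - P^`().[s]| <= M * s ^+ m.+1 / m.+1`!%:R.
  move=> /sub_oo s01; rewrite dPE.
  have gc' k : (k < m)%N -> {within `[0, 1], continuous g k.+1}.
    by move=> km; exact: (gc k.+1 km).
  have gd' k (u : R) : (k < m)%N -> u \in `]0, 1[ ->
    is_derive u 1 (g k.+1) (g k.+2 u).
    by move=> km; exact: (gd k.+1 u km).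
  by have := IH (fun k => g k.+1) gc' gd' gM s; apply; exact: subset_itv_oo_cc.
have := le_power_of_derive_le t_gt0 hc hd h'M.
have -> : h t - h 0 = g 0%N t - \sum_(j < m.+2) g j 0 / j`!%:R * t ^+ j.
  by rewrite /h PE horner_coef0 coef_poly/= fact0 divr1 subrr subr0.
by [].
Qed.

End taylor_one_variable.

(** * Differentiability relative to the unit interval, in epsilon form *)

Section derivative_within_unit_interval.
Context (R : realType) (h : R -> R) (d t : R).
Hypothesis hd : forall eps : R, 0 < eps ->
  \forall s \near within `[0, 1] (nbhs t),
    `|h s - h t - (s - t) * d| <= eps * `|s - t|.

Lemma cvg_within_of_derivative :
  h s @[s --> within `[0, 1] (nbhs t)] --> h t.
Proof.
apply/cvgrPdistC_le => eps eps0.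
have d1 : 0 < 1 + `|d| by rewrite ltr_pwDl.
near=> s.
(* With tolerance 1, the increment of [h] is at most (1 + |d|) |s - t|. *)
have hs : `|h s - h t - (s - t) * d| <= 1 * `|s - t|.
  by near: s; exact: hd.
have st : `|s - t| <= eps / (1 + `|d|).
  near: s; apply: cvg_within.
  apply: (@cvgr_distC_le _ _ _ (nbhs t) _ id t); first exact: cvg_id.
  exact: divr_gt0.
rewrite -(subrK ((s - t) * d) (h s - h t)) (le_trans (ler_normD _ _))//.
rewrite (le_trans (lerD hs (lexx _)))// normrM mulrC -mulrDr.
by rewrite -ler_pdivlMr.
Unshelve. all: by end_near. Qed.

(** All points near an interior [t] lie in [0, 1], so the relative estimate at s = e + t controls
    the two-sided difference quotient. *)
Lemma is_derive_of_derivative_within : t \in `]0, 1[ -> is_derive t 1 h d.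
Proof.
move=> t01.
have cvgd : e^-1 *: (h (e *: 1 + t) - h t) @[e --> 0^'] --> d.
  apply/cvgrPdistC_le => eps eps0.
  have hd_near : \forall s \near t,
      s \in `]0, 1[ -> `|h s - h t - (s - t) * d| <= eps * `|s - t|.
    move: (hd eps0); rewrite near_withinE; apply: filterS => s hs s01.
    by apply: hs; exact: subset_itv_oo_cc.
  have t_near : \forall s \near t, s \in `]0, 1[.
    by apply: (near_in_itvoo t01).
  have cvgt : e *: 1 + t @[e --> (0 : R)^'] --> t.
    apply: cvg_within_filter.
    have : e *: (1 : R) + t @[e --> (0 : R)] --> 0 *: (1 : R) + t.
      by apply: cvgD; [apply: cvgZr_tmp; exact: cvg_id|exact: cvg_cst].
    by rewrite scale0r add0r.
  near=> e.
  have e0 : e != 0 by near: e; exact: nbhs_dnbhs_neq.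
  have es01 : e *: 1 + t \in `]0, 1[ by near: e; exact: (cvgt _ t_near).
  have : e *: 1 + t \in `]0, 1[ -> `|h (e *: 1 + t) - h t - (e *: 1 + t - t) * d|
      <= eps * `|e *: 1 + t - t|.
    by near: e; exact: (cvgt _ hd_near).
  move=> /(_ es01); rewrite addrK [e *: 1]mulr1 => he.
  have -> : e^-1 *: (h (e + t) - h t) - d = e^-1 * (h (e + t) - h t - e * d).
    by rewrite mulrBr mulKf.
  by rewrite normrM normfV mulrC ler_pdivrMr ?normr_gt0.
apply: DeriveDef; first by apply/cvg_ex; exists d.
exact: cvg_lim.
Unshelve. all: by end_near. Qed.

End derivative_within_unit_interval.

(** * Homogeneity of multilinear forms *)

Section multilinear_forms.
Context (R : realType) (V : normedModType R).

Lemma multilinear_dfwithZ k (M : form_on V k) h i (a : R) u :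
  multilinear M -> M (dfwith h i (a *: u)) = a * M (dfwith h i u).
Proof. by move=> /(_ h i)/scalable_linear/(_ a u). Qed.

Lemma multilinearZ k (M : form_on V k) (a : R) h :
  multilinear M -> M (fun i => a *: h i) = a ^+ k * M h.
Proof.
move=> Ml.
(* For the induction, only the arguments indexed by [s] are scaled, one slot at a time; the full
   enumeration gives the claim. *)
suff H (s : seq 'I_k) : uniq s ->
    M (fun i => if i \in s then a *: h i else h i) = a ^+ size s * M h.
  rewrite -[in RHS](size_enum_ord k) -H ?enum_uniq//; congr M.
  by apply/funext => i; rewrite mem_enum.
elim: s => [_|i s IH /= /andP[s'i us]]; first by rewrite mul1r.
rewrite exprS -mulrA -IH//; set g := fun j => if j \in s then _ else _.
have -> : (fun j => if j \in i :: s then a *: h j else h j) =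
    dfwith g i (a *: h i).
  apply/funext => j; case: dfwithP => [|l il]; first by rewrite mem_head.
  by rewrite inE eq_sym (negbTE il).
rewrite multilinear_dfwithZ//; congr (_ * M _).
apply/funext => j; case: dfwithP => //.
by rewrite /g (negbTE s'i).
Qed.

Lemma ocons_cstE k (a : R) (v : V) :
  ocons (a *: v) (fun=> v) = dfwith (fun=> v) (@ord0 k) (a *: v).
Proof.
apply/funext => j; rewrite /ocons; case: unliftP => [i ->|->].
  by rewrite dfwithout// neq_lift.
by rewrite dfwithin.
Qed.

End multilinear_forms.

(** * Taylor's formula along a segment *)

Section taylor_segment.
Context (R : realType) (V : normedModType R) (A : set V) (f : V -> R) (p : nat).
Context (D : forall k, V -> form_on V k) (L : R).
Hypothesis f_deriv : derivatives_on A f p (@D).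
Hypothesis f_lip : lipschitz_form A (@D p) L.

(** The form norm tests only the unit ball, so [v] is normalized and |v|^p is recovered by
    homogeneity. It is a supremum of signed values; exchanging the two points gives the absolute
    value. *)
Lemma lipschitz_form_cst x y v : A x -> A y ->
  `|@D p x (fun=> v) - @D p y (fun=> v)| <= L * `|x - y| * `|v| ^+ p.
Proof.
move=> Ax Ay.
pose u := `|v|^-1 *: v.
have u1 : `|u| <= 1.
  rewrite normrZ normfV normr_id.
  have [->|v0] := eqVneq v 0; first by rewrite normr0 mulr0.
  by rewrite mulVf// normr_eq0.
have vE : v = `|v| *: u.
  rewrite scalerA; have [->|v0] := eqVneq v 0; first by rewrite scaler0.
  by rewrite divff ?normr_eq0// scale1r.
have DE z : A z -> @D p z (fun=> v) = `|v| ^+ p * @D p z (fun=> u).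
  move=> Az; rewrite {1}vE (@multilinearZ _ _ _ _ _ (fun=> u))//.
  exact: (derivatives_on_multilinear f_deriv).
have Du z w : A z -> A w -> @D p z (fun=> u) - @D p w (fun=> u) <= L * `|z - w|.
  move=> Az Aw; rewrite -lee_fin (le_trans _ (f_lip Az Aw))//.
  by apply: ereal_sup_ubound; exists (fun=> u).
rewrite !DE// -mulrBr normrM normrX normr_id mulrC ler_wpM2r ?exprn_ge0//.
by rewrite ler_norml Du// andbT lerNl opprB distrC Du.
Qed.

(** Chain rule along s -> x + s v: the displacement is (s - t) v, and linearity in the first slot
    pulls s - t out of the next derivative. *)
Lemma derivative_on_segment x v k (t eps : R) : (k < p)%N ->
  (forall s : R, s \in `[0, 1] -> A (x + s *: v)) -> t \in `[0, 1] -> 0 < eps ->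
  \forall s \near within `[0, 1] (nbhs t),
    `|@D k (x + s *: v) (fun=> v) - @D k (x + t *: v) (fun=> v)
      - (s - t) * @D k.+1 (x + t *: v) (fun=> v)| <= eps * `|s - t|.
Proof.
move=> kp Aseg t01 eps0.
(* Dividing [eps] by 1 + |v| rather than |v| also covers v = 0. *)
have v1 : 0 < 1 + `|v| by rewrite ltr_pwDl.
have zE s : x + s *: v - (x + t *: v) = (s - t) *: v.
  by rewrite opprD addrACA subrr add0r -scalerBl.
have /eqoP/(_ (eps / (1 + `|v|))) := derivatives_onS f_deriv (fun _ : 'I_k => v)
  kp (Aseg _ t01).
move=> /(_ (divr_gt0 eps0 v1)).
have zcvg : x + s *: v @[s --> nbhs t] --> x + t *: v.
  by apply: cvgD; [exact: cvg_cst|apply: cvgZr_tmp; exact: cvg_id].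
rewrite near_withinE => /= /zcvg Dnear; rewrite near_withinE.
apply: (@filterS _ (nbhs t) _ _ _ _ Dnear) => s /= Hs s01.
have := Hs (Aseg _ s01); rewrite zE ocons_cstE multilinear_dfwithZ; last first.
  by apply: (derivatives_on_multilinear f_deriv) => //; exact: Aseg.
have -> : dfwith (fun=> v) (@ord0 k) v = (fun=> v).
  by apply/funext => j; case: dfwithP.
move=> /le_trans; apply; rewrite normrZ mulrCA mulrC ler_wpM2r// -mulrA.
by rewrite -[leRHS]mulr1 ler_wpM2l ?(ltW eps0)// mulrC ler_pdivrMr// mul1r lerDr.
Qed.

Lemma taylor_form_le x v : (forall s : R, s \in `[0, 1] -> A (x + s *: v)) ->
  `|f (x + v) - \sum_(j < p.+1) (j`!%:R)^-1 * @D j x (fun=> v)|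
    <= L * `|v| ^+ p.+1 / p.+1`!%:R.
Proof.
move=> Aseg.
(* [g k] is the kth derivative of s -> f(x + s v); the one-variable formula is used at t = 1 with
   constant L |v|^(p+1). *)
pose g k s := @D k (x + s *: v) (fun=> v).
have gc k : (k < p)%N -> {within `[0, 1], continuous g k}.
  move=> kp; apply/subspace_continuousP => t t01.
  apply: cvg_within_of_derivative => eps; exact: derivative_on_segment.
have gd k (t : R) : (k < p)%N -> t \in `]0, 1[ -> is_derive t 1 (g k) (g k.+1 t).
  move=> kp t01; apply: is_derive_of_derivative_within => // eps.
  by apply: derivative_on_segment => //; exact: subset_itv_oo_cc.
have i0 : 0 \in `[0, (1 : R)] by rewrite in_itv/= lexx ler01.
have i1 : 1 \in `[0, (1 : R)] by rewrite in_itv/= lexx ler01.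
have gM (t : R) : t \in `[0, 1] -> `|g p t - g p 0| <= L * `|v| ^+ p.+1 * t.
  move=> t01; rewrite (le_trans (lipschitz_form_cst _ (Aseg _ t01) (Aseg _ i0)))//.
  have t0 : 0 <= t by move: t01; rewrite in_itv/= => /andP[].
  rewrite scale0r addr0 addrC addKr normrZ (ger0_norm t0) exprS.
  by rewrite le_eqVlt; apply/orP; left; apply/eqP; ring.
have := taylor_le gc gd gM i1.
rewrite expr1n mulr1 /g scale1r scale0r addr0.
rewrite (derivatives_on0 f_deriv); last by have := Aseg _ i1; rewrite scale1r.
by under eq_bigr do rewrite expr1n mulr1 mulrC.
Qed.

End taylor_segment.

(** * Progress made by one inexact tensor step *)

Section tensor_step.
Context (R : realType) (V : normedModType R) (f : V -> R) (psi : V -> \bar R).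
Context (p : nat) (D : forall k, V -> form_on V k) (L : R).
Hypothesis psi_proper : proper_fun psi.
Hypothesis psi_convex : convex_fun psi.
Hypothesis f_deriv : derivatives_on (effdom psi) f p (@D).
Hypothesis L_ge0 : 0 <= L.
Hypothesis f_lip : lipschitz_form (effdom psi) (@D p) L.

Lemma effdom_fineK y : effdom psi y -> (fine (psi y))%:E = psi y.
Proof.
move=> psiy; rewrite fineK// fin_real// psiy andbT.
by rewrite lt_neqAle eq_sym leNye psi_proper.1.
Qed.

(** The right-hand side of the convexity inequality is finite, which forces the left-hand side to be
    finite and lets the inequality pass to the reals. *)
Lemma fine_convex x y (t : R) : effdom psi x -> effdom psi y -> 0 <= t <= 1 ->
  effdom psi (t *: x + (1 - t) *: y) /\
  fine (psi (t *: x + (1 - t) *: y)) <=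
    t * fine (psi x) + (1 - t) * fine (psi y).
Proof.
move=> dx dy t01; have h := psi_convex x y t01.
rewrite -(effdom_fineK dx) -(effdom_fineK dy) -!EFinM -EFinD in h.
have dz : effdom psi (t *: x + (1 - t) *: y) by exact: le_lt_trans h (ltry _).
split; first exact: dz.
by rewrite -lee_fin effdom_fineK.
Qed.

Lemma segment_effdom x y (t : R) : effdom psi x -> effdom psi y ->
  t \in `[0, 1] -> effdom psi (x + t *: (y - x)).
Proof.
move=> dx dy; rewrite in_itv/= => t01.
have [] := fine_convex dy dx t01.
by rewrite scalerBl scalerBr scale1r addrCA.
Qed.

Lemma taylor_effdom_le x y : effdom psi x -> effdom psi y ->
  `|f y - (f x + \sum_(1 <= k < p.+1) (k`!%:R)^-1 * @D k x (fun=> y - x))|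
    <= L * `|y - x| ^+ p.+1 / p.+1`!%:R.
Proof.
move=> dx dy.
have := taylor_form_le f_deriv f_lip (fun t => @segment_effdom x y t dx dy).
rewrite [x + (y - x)]addrC subrK -(big_mkord xpredT
  (fun j => (j`!%:R)^-1 * @D j x (fun=> y - x))).
by rewrite big_nat_recl// big_add1 fact0 invr1 mul1r (derivatives_on0 f_deriv).
Qed.

Let F y := f y + fine (psi y).

Lemma inexact_step_le (delta : R) x y T : (1 <= p)%N ->
  effdom psi x -> effdom psi y ->
  inexact_step p f (@D) psi (p%:R * L) delta x T ->
  F T <= F y + L * `|y - x| ^+ p.+1 / p`!%:R + delta.
Proof.
move=> p1 dx dy [dT]; set m := model _ _ _ _ _ _ => mT.
have mE z : effdom psi z -> m z = (f x
    + \sum_(1 <= k < p.+1) (k`!%:R)^-1 * @D k x (fun=> z - x)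
    + p%:R * L * `|z - x| ^+ p.+1 / p.+1`!%:R + fine (psi z))%:E.
  by move=> dz; rewrite /m /model -(effdom_fineK dz).
have : (m T <= delta%:E + m y)%E.
  have := ereal_inf_lbound (imageT m y); move: mT.
  have := ereal_inf_lbound (imageT m T); rewrite !mE//.
  (* Infimum +oo contradicts the finite value at [T]; -oo would make the gap at [T] infinite, hence
     not below [delta]. *)
  case: ereal_inf => [r||] //=.
  by rewrite -EFinB -EFinD !lee_fin => *; lra.
rewrite !mE// -EFinD lee_fin /F.
have := taylor_effdom_le dx dT; have := taylor_effdom_le dx dy.
set Sy := \sum_(_ <= _ < _) _; set ST := \sum_(_ <= _ < _) _.
set u := `|y - x| ^+ p.+1; set w := `|T - x| ^+ p.+1.
(* As p >= 1, the regularizer dominates the Taylor error at [T], so F(T) is at most the model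
   value. *)
have wL : L * w / p.+1`!%:R <= p%:R * L * w / p.+1`!%:R.
  rewrite ler_wpM2r ?invr_ge0// ler_wpM2r ?exprn_ge0// ler_peMl//.
  by rewrite ler1n.
(* At [y], the Taylor error and the regularizer add up: (1 + p)/(p+1)! = 1/p!. *)
have uL : L * u / p.+1`!%:R + p%:R * L * u / p.+1`!%:R = L * u / p`!%:R.
  rewrite factS natrM.
  have : (p.+1%:R : R) != 0 by [].
  have : (p`!%:R : R) != 0 by rewrite pnatr_eq0 -lt0n fact_gt0.
  by move=> ? ?; field; rewrite nat1r; apply/andP.
rewrite !ler_norml => /andP[uy1 uy2] /andP[wT1 wT2] mTy.
lra.
Qed.

End tensor_step.

(** * Convex combinations, averaging weights and the convergence rate *)

Lemma convex_function_le (R : realType) (V : lmodType R) (A : set V) (f : V -> R)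
    (x y : V) (t : R) :
  convex_function A f -> A x -> A y -> 0 <= t <= 1 ->
  f (t *: x + (1 - t) *: y) <= t * f x + (1 - t) * f y.
Proof.
move=> cf Ax Ay /andP[t0 t1].
by have := cf (Itv01 t0 t1) x y; rewrite !inE => /(_ Ax Ay); rewrite convRE.
Qed.

Lemma avg_weight_itv (R : realType) p k : 0 <= avg_weight R p k <= 1.
Proof.
rewrite /avg_weight exprn_ge0 ?divr_ge0//= exprn_ile1 ?divr_ge0//.
by rewrite ler_pdivrMr// mul1r ler_nat.
Qed.

Lemma avg_weightM (R : realType) p k :
  k.+1%:R ^+ p.+1 * avg_weight R p k = k%:R ^+ p.+1.
Proof. by rewrite /avg_weight -exprMn mulrC divfK. Qed.

(* Bernoulli's inequality, as the weight is [(1 - 1 / k.+1) ^+ p.+1]. *)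
Lemma avg_weight_onem_le (R : realType) p k :
  k.+1%:R * (1 - avg_weight R p k) <= p.+1%:R.
Proof.
rewrite /avg_weight; set q : R := k%:R / k.+1%:R.
have /andP[q0 q1] : 0 <= q <= 1.
  by rewrite divr_ge0//= ler_pdivrMr// mul1r ler_nat.
have kq : k.+1%:R * (1 - q) = 1.
  by rewrite mulrBr mulr1 mulrC divfK// -natrB// subSnn.
elim: p => [|p IH]; first by rewrite expr1 kq.
have -> : k.+1%:R * (1 - q ^+ p.+2) =
    k.+1%:R * (1 - q) + q * (k.+1%:R * (1 - q ^+ p.+1)).
  by rewrite [q ^+ p.+2]exprS; ring.
rewrite kq -[p.+2%:R]natr1 addrC lerD2r (le_trans _ IH)// ler_piMl//.
by rewrite mulr_ge0// subr_ge0 exprn_ile1.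
Qed.

Theorem theorem5 (R : realType) (E : vectType R) (B : spd_op E) (p : nat)
    (f : euclidean B -> R) (psi : euclidean B -> \bar R)
    (D : forall k, euclidean B -> form_on (euclidean B) k)
    (L c : R) (xs : euclidean B) (x : nat -> euclidean B)
    (p_ge1 : (1 <= p)%N)
    (psi_proper : proper_fun psi)
    (psi_closed : closed_fun psi)
    (psi_convex : convex_fun psi)
    (f_convex : convex_function (effdom psi) f)
    (f_deriv : derivatives_on (effdom psi) f p D)
    (L_ge0 : 0 <= L)
    (f_lip : lipschitz_form (effdom psi) (D p) L)
    (xs_sol : solution f psi xs)
    (c_ge0 : 0 <= c)
    (x_method : inexact_tensor_averaging p f D psi L
                  (fun k => c / k%:R ^+ p.+1) x) :
  forall k : nat, (1 <= k)%N ->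
    (objective f psi (x k) - objective f psi xs <=
     (p.+1%:R ^+ p.+1 * L * `|x 0%N - xs| ^+ p.+1 / (p`!%:R * k%:R ^+ p)
      + c / k%:R ^+ p)%:E)%E.
Proof.
pose F y := f y + fine (psi y).
case: xs_sol => dxs _; case: x_method => dx0 step.
have dx k : effdom psi (x k) by case: k => // k; case: (step k).
set K := p.+1%:R ^+ p.+1 * L * `|x 0%N - xs| ^+ p.+1 / p`!%:R.
(* Starting at k = 0, where both sides vanish, avoids any bound on the initial gap. *)
have rec k : k%:R ^+ p.+1 * (F (x k) - F xs) <= k%:R * (K + c).
  elim: k => [|k IH]; first by rewrite expr0n !mul0r.
  set n : R := k.+1%:R; set l := avg_weight R p k.
  have l01 : 0 <= l <= 1 by exact: avg_weight_itv.
  have [dyk _] := fine_convex psi_proper psi_convex (dx k) dx0 l01.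
  have [dy psiy] := fine_convex psi_proper psi_convex (dx k) dxs l01.
  have fy := convex_function_le f_convex (dx k) dxs l01.
  have := inexact_step_le psi_proper psi_convex f_deriv L_ge0 f_lip
    p_ge1 dyk dy (step k).
  rewrite /averaging_point -/l opprD addrACA subrr add0r -scalerBr normrZ.
  rewrite (distrC xs) ger0_norm; last by case/andP: l01 => _; rewrite subr_ge0.
  rewrite -/(F (x k.+1)) exprMn => Fx.
  have n0 : 0 < n ^+ p.+1 by rewrite exprn_gt0.
  have nl : n ^+ p.+1 * l = k%:R ^+ p.+1 by exact: avg_weightM.
  (* Bernoulli's bound n (1 - l) <= p + 1, raised to the power p + 1; this is the source of the
     factor (p+1)^(p+1) in [K]. *)
  have nl1 : n ^+ p.+1 * (1 - l) ^+ p.+1 <= p.+1%:R ^+ p.+1.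
    rewrite -exprMn lerXn2r ?nnegrE//; last exact: avg_weight_onem_le.
    by rewrite mulr_ge0// subr_ge0; case/andP: l01.
  have nK : n ^+ p.+1 * (L * ((1 - l) ^+ p.+1 * `|x 0%N - xs| ^+ p.+1) / p`!%:R)
      <= K.
    have -> : n ^+ p.+1 * (L * ((1 - l) ^+ p.+1 * `|x 0%N - xs| ^+ p.+1) / p`!%:R)
        = n ^+ p.+1 * (1 - l) ^+ p.+1 * (L * `|x 0%N - xs| ^+ p.+1 / p`!%:R).
      by rewrite !mulrA; congr (_ / _); ring.
    rewrite /K -[X in _ <= X / _]mulrA -[leRHS]mulrA ler_wpM2r//.
    by rewrite divr_ge0// mulr_ge0// exprn_ge0.
  (* The accuracy rule makes every step contribute the same weighted error [c]. *)
  have nc : n ^+ p.+1 * (c / n ^+ p.+1) = c by rewrite mulrC divfK ?gt_eqF.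
  have Fle : F (x k.+1) - F xs <= l * (F (x k) - F xs)
      + L * ((1 - l) ^+ p.+1 * `|x 0%N - xs| ^+ p.+1) / p`!%:R + c / n ^+ p.+1.
    by rewrite /F in Fx *; lra.
  apply: le_trans (ler_wpM2l (ltW n0) Fle) _.
  rewrite [X in X <= _]mulrDr nc [X in X + c]mulrDr [n ^+ p.+1 * (l * _)]mulrA nl.
  have -> : n * (K + c) = k%:R * (K + c) + (K + c).
    by rewrite /n -natr1 mulrDl mul1r.
  by rewrite -addrA lerD// lerD2r.
move=> k k1.
rewrite /objective -(effdom_fineK psi_proper (dx k)) -(effdom_fineK psi_proper dxs).
rewrite -!EFinD lee_fin -/(F (x k)) -/(F xs).
have k0 : 0 < k%:R :> R by rewrite ltr0n.
(* The target bound is (K + c)/k^p; multiplying by k^p and then by k gives the recursive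
   estimate. *)
rewrite invfM [_ * (_^-1 / _)]mulrA -/K -mulrDl ler_pdivlMr ?exprn_gt0//.
by rewrite -(ler_pM2l k0) mulrCA -exprS mulrC; exact: rec.
Qed.
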